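(* Let $K=\mathbb{F}_q$ be a finite field with $q\neq 2$. If $G$ is a connected bipartite graph with $n$ vertices and with a largest cycle of length $2k$, and $X$ is the projective algebraic toric set parameterized by the edges of $G$ (defined in the context), then $${\rm reg}\, S/I(X)\leq (q-2)(n-k-1).$$
   Context: Graphs are finite and simple. ''A largest cycle of length $2k$'' means that $G$ has a cycle of length $2k$ and no longer cycle. Let $G$ have vertex set $\{y_1,\ldots,y_n\}$ and edges $f_1,\ldots,f_s$, and let $v_i=e_j+e_k\in\{0,1\}^n$ be the characteristic vector of $f_i=\{y_j,y_k\}$. Put $K^*=K\setminus\{0\}$ and, for $x\in (K^* )^n$, $x^{v_i}=x_1^{v_{i1}}\cdots x_n^{v_{in}}$. The projective algebraic toric set parameterized by the edges of $G$ is $X=\{[(x^{v_1},\ldots,x^{v_s})] : x\in (K^* )^n\}\subset\mathbb{P}^{s-1}$, the projective space over $K$. $S=K[t_1,\ldots,t_s]$ is a polynomial ring with the standard grading, and $I(X)$ is the ideal of $S$ generated by the homogeneous polynomials vanishing on $X$. The Hilbert function is $H_X(d)=\dim_K (S/I(X))_d$; it is constant, equal to $|X|$, for $d\gg 0$, and ${\rm reg}\,S/I(X)$ is the least integer $p\geq 0$ such that $H_X(d)=|X|$ for all $d\geq p$ (this equals the Castelnuovo-Mumford regularity). *)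

(* Defs.v *)
From mathcomp Require Import all_boot all_order all_algebra.
From mathcomp Require Import boolp.
From mathcomp Require Import mpoly.

Set Implicit Arguments.
Unset Strict Implicit.
Unset Printing Implicit Defensive.

Import GRing.Theory.

Local Open Scope ring_scope.

Definition simple_graph (n : nat) (G : rel 'I_n) : Prop :=
  ssrbool.symmetric G /\ irreflexive G.

Definition edge_set (n : nat) (G : rel 'I_n) : {set {set 'I_n}} :=
  [set [set p.1; p.2] | p : 'I_n * 'I_n & G p.1 p.2].

Definition edge_enumeration (n s : nat) (G : rel 'I_n)
    (f : s.-tuple {set 'I_n}) : Prop :=
  uniq f /\ f =i edge_set G.

Definition connected_graph (n : nat) (G : rel 'I_n) : Prop :=
  (0 < n)%N /\ forall x y, connect G x y.

Definition bipartite (n : nat) (G : rel 'I_n) : Prop :=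
  exists A : {set 'I_n}, forall x y, G x y -> (x \in A) != (y \in A).

(** [ucycle] also accepts the empty sequence and [:: x; y] for an edge [xy];
    the bound on the size excludes these. *)
Definition graph_cycle (n : nat) (G : rel 'I_n) (c : seq 'I_n) : Prop :=
  (2 < size c)%N /\ ucycle G c.

Definition largest_cycle_length (n : nat) (G : rel 'I_n) (l : nat) : Prop :=
  (exists2 c, graph_cycle G c & size c = l) /\
  (forall c, graph_cycle G c -> (size c <= l)%N).

(** The point of projective space with homogeneous coordinates [v], encoded as
    the set of all its representatives; meaningful for [v != 0] only. *)
Definition proj_point (K : finFieldType) (s : nat) (v : 'rV[K]_s) :
    {set 'rV[K]_s} :=
  [set a *: v | a : K & a != 0].

Definition char_vec (n : nat) (A : {set 'I_n}) (j : 'I_n) : nat := j \in A.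

Definition toric_param (K : finFieldType) (n s : nat)
    (f : s.-tuple {set 'I_n}) (x : 'rV[K]_n) : 'rV[K]_s :=
  \row_(i < s) \prod_(j < n) x 0 j ^+ char_vec (tnth f i) j.

Definition toric_set (K : finFieldType) (n s : nat)
    (f : s.-tuple {set 'I_n}) : {set {set 'rV[K]_s}} :=
  [set proj_point (toric_param f x) | x : 'rV[K]_n & [forall j, x 0 j != 0]].

Definition ideal_gen (R : comNzRingType) (A : R -> Prop) (p : R) : Prop :=
  exists (m : nat) (c g : 'I_m -> R),
    (forall i, A (g i)) /\ p = \sum_(i < m) c i * g i.

Definition homog_vanishing (K : finFieldType) (s : nat)
    (X : {set {set 'rV[K]_s}}) (g : {mpoly K[s]}) : Prop :=
  (exists d : nat, g \is d.-homog) /\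
  (forall P v, P \in X -> v \in P -> g.@[v 0] = 0).

Definition vanishing_ideal (K : finFieldType) (s : nat)
    (X : {set {set 'rV[K]_s}}) : {mpoly K[s]} -> Prop :=
  ideal_gen (homog_vanishing X).

(** The residue classes of [b] form a basis of the image of [W] in [V / U]. *)
Definition basis_mod (K : fieldType) (V : lmodType K) (W U : V -> Prop)
    (h : nat) (b : 'I_h -> V) : Prop :=
  [/\ forall i, W (b i),
      forall v, W v -> exists c : 'I_h -> K, U (v - \sum_(i < h) c i *: b i)
    & forall c : 'I_h -> K, U (\sum_(i < h) c i *: b i) -> forall i, c i = 0].

Lemma free_mod_leq (K : fieldType) (V : lmodType K) (U : V -> Prop)
    (m h : nat) (b : 'I_m -> V) (g : 'I_h -> V) :
  U 0 -> (forall u v, U u -> U v -> U (u + v)) ->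
  (forall (a : K) u, U u -> U (a *: u)) ->
  (forall i, exists c : 'I_h -> K, U (b i - \sum_(j < h) c j *: g j)) ->
  (forall c : 'I_m -> K, U (\sum_(i < m) c i *: b i) -> forall i, c i = 0) ->
  (m <= h)%N.
Proof.
move=> U0 UD UZ gen fr; rewrite leqNgt; apply/negP => lt_hm.
have [c cP] : exists c : 'I_m -> 'I_h -> K,
    forall i, U (b i - \sum_(j < h) c i j *: g j).
  by exists (fun i => sval (cid (gen i))) => i; case: (cid _).
pose A := \matrix_(i < m, j < h) c i j.
have /rowV0Pn [u /sub_kermxP uA u0] : kermx A != 0.
  by rewrite kermx_eq0 /row_free neq_ltn (leq_ltn_trans (rank_leq_col A)).
case/negP: u0; apply/eqP/rowP => i; rewrite mxE.
apply: (fr (fun i => u 0 i)).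
have -> : \sum_(i < m) u 0 i *: b i =
    \sum_(i < m) u 0 i *: (b i - \sum_(j < h) c i j *: g j).
  under [RHS]eq_bigr => l _ do rewrite scalerBr scaler_sumr.
  rewrite sumrB exchange_big /= [X in _ - X]big1 ?subr0 // => j _.
  under eq_bigr => l _ do rewrite scalerA.
  rewrite -scaler_suml.
  have := congr1 (fun B : 'rV[K]_h => B 0 j) uA; rewrite !mxE.
  by under eq_bigr => l _ do rewrite mxE; move=> ->; rewrite scale0r.
by elim/big_ind: _ => // l _; apply: UZ.
Qed.

Lemma basis_mod_size (K : fieldType) (V : lmodType K) (W U : V -> Prop)
    (m h : nat) (b : 'I_m -> V) (g : 'I_h -> V) :
  U 0 -> (forall u v, U u -> U v -> U (u + v)) ->
  (forall (a : K) u, U u -> U (a *: u)) ->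
  basis_mod W U b -> basis_mod W U g -> m = h.
Proof.
move=> U0 UD UZ [Wb gb fb] [Wg gg fg]; apply/eqP; rewrite eqn_leq.
by rewrite (@free_mod_leq _ _ U m h b g) ?(@free_mod_leq _ _ U h m g b) // => i;
   [apply: gb | apply: gg].
Qed.

Lemma vanishing_ideal0 (K : finFieldType) (s : nat)
    (X : {set {set 'rV[K]_s}}) : vanishing_ideal X 0.
Proof. by exists 0%N, (fun=> 0), (fun=> 0); split=> [[]//|]; rewrite big_ord0. Qed.

Lemma vanishing_idealD (K : finFieldType) (s : nat)
    (X : {set {set 'rV[K]_s}}) (p q : {mpoly K[s]}) :
  vanishing_ideal X p -> vanishing_ideal X q -> vanishing_ideal X (p + q).
Proof.
move=> [m [c [g [gP ->]]]] [m' [c' [g' [gP' ->]]]].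
pose join (a : 'I_m -> {mpoly K[s]}) a' (i : 'I_(m + m')) :=
  match split i with inl j => a j | inr j => a' j end.
exists (m + m')%N, (join c c'), (join g g'); split=> [i|].
  by rewrite /join; case: (split i).
rewrite big_split_ord /=; congr (_ + _); apply: eq_bigr => i _; rewrite /join.
  by rewrite (unsplitK (inl i)).
by rewrite (unsplitK (inr i)).
Qed.

Lemma vanishing_idealZ (K : finFieldType) (s : nat)
    (X : {set {set 'rV[K]_s}}) (a : K) (p : {mpoly K[s]}) :
  vanishing_ideal X p -> vanishing_ideal X (a *: p).
Proof.
move=> [m [c [g [gP ->]]]]; exists m, (fun i => a *: c i), g; split=> //.
by rewrite scaler_sumr; apply: eq_bigr => i _; rewrite scalerAl.
Qed.

(** As [I(X)] is a homogeneous ideal, [(S/I(X))_d] is the image of [S_d]. *)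
Definition hilbert_basis (K : finFieldType) (s : nat)
    (X : {set {set 'rV[K]_s}}) (d h : nat) (b : 'I_h -> {mpoly K[s]}) : Prop :=
  basis_mod (fun p : {mpoly K[s]} => p \is d.-homog) (vanishing_ideal X) b.

Lemma hilbert_basis_exists (K : finFieldType) (s : nat)
    (X : {set {set 'rV[K]_s}}) (d : nat) :
  exists h : nat, exists b : 'I_h -> {mpoly K[s]}, hilbert_basis X d b.
Proof.
set I := vanishing_ideal X.
pose fr h (b : 'I_h -> {mpoly K[s]}) := (forall i, b i \is d.-homog) /\
  (forall c : 'I_h -> K, I (\sum_(i < h) c i *: b i) -> forall i, c i = 0).
pose T : finType := 'X_{1..s < d.+1}.
have bnd h (b : 'I_h -> {mpoly K[s]}) : fr h b -> (h <= #|T|)%N.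
  case=> hb; apply: (@free_mod_leq _ _ I h #|T| b
    (fun j => 'X_[bmnm (enum_val j : T)])).
  - exact: vanishing_ideal0.
  - exact: vanishing_idealD.
  - exact: vanishing_idealZ.
  move=> i; exists (fun j => (b i)@_(bmnm (enum_val j : T))).
  rewrite [X in X - _](_ : _ = \sum_(m : T) (b i)@_m *: 'X_[m]); last first.
    apply: mpolywE; rewrite msizeE; apply/bigmax_leqP_seq => m mb _.
    by rewrite ltnS (dhomog_mf (hb i)).
  rewrite (reindex (@enum_val T predT)) /=; last first.
    by apply: onW_bij; apply: enum_val_bij.
  by rewrite subrr; apply: vanishing_ideal0.
pose P h := `[< exists b, fr h b >].
have exP : exists h, P h.
  by exists 0%N; apply/asboolP; exists (fun=> 0); split=> [[]//|c _ []].
have ubP h : P h -> (h <= #|T|)%N by case/asboolP => b; apply: bnd.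
case: (ex_maxnP exP ubP) => h /asboolP [b [hb fb]] hmax.
exists h, b; split=> // v hv; apply: contrapT => nspan.
suff /hmax : P h.+1 by rewrite ltnn.
apply/asboolP; exists (fun i => if unlift ord0 i is Some j then b j else v).
split=> [i|c]; first by case: (unlift _ _).
rewrite big_ord_recl unlift_none /=; under eq_bigr => j _ do rewrite liftK.
move=> Ic; have c0 : c ord0 = 0.
  apply: contrapT => /eqP c0; apply: nspan.
  exists (fun j => - ((c ord0)^-1 * c (lift ord0 j))).
  rewrite (_ : _ - _ = (c ord0)^-1 *:
    (c ord0 *: v + \sum_(j < h) c (lift ord0 j) *: b j)).
    exact: vanishing_idealZ.
  rewrite scalerDr scalerA mulVf // scale1r scaler_sumr -sumrN; congr (_ + _).
  by apply: eq_bigr => j _; rewrite scaleNr opprK scalerA.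
move: Ic; rewrite c0 scale0r add0r => /fb cl i.
by case: (unliftP ord0 i) => [j ->|-> //]; apply: cl.
Qed.

Definition hilbert (K : finFieldType) (s : nat) (X : {set {set 'rV[K]_s}})
    (d : nat) : nat :=
  sval (cid (hilbert_basis_exists X d)).

Lemma hilbertP (K : finFieldType) (s : nat) (X : {set {set 'rV[K]_s}})
    (d h : nat) :
  hilbert X d = h <-> exists b : 'I_h -> {mpoly K[s]}, hilbert_basis X d b.
Proof.
rewrite /hilbert; case: (cid _) => m /= mP; split=> [<- //|[b bP]].
case: mP => b' bP'; apply: basis_mod_size bP' bP.
- exact: vanishing_ideal0.
- exact: vanishing_idealD.
- exact: vanishing_idealZ.
Qed.

Definition is_regularity (K : finFieldType) (s : nat)
    (X : {set {set 'rV[K]_s}}) (r : nat) : Prop :=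
  (forall d, (r <= d)%N -> hilbert X d = #|X|) /\
  (forall p, (forall d, (p <= d)%N -> hilbert X d = #|X|) -> (r <= p)%N).

(* Main.v *)
(* The Hilbert function takes the value |X| in degree d as soon as every point
   of X is separated from the others by a form of degree d. On the torus, the
   indicator function of a point is a product of geometric sums, hence a
   combination of all monomials x^g with exponents modulo q - 1, and it suffices
   to realize each of them as a monomial of degree d in the edges. Two exponents,
   those at the ends of an edge of a longest cycle, may be chosen freely, since
   the two sides of the bipartition can be rescaled independently. Each vertex
   outside the cycle is attached by an edge whose weight, at most q - 2, is its
   residue; on the cycle of length 2k the edge weights are determined by one
   parameter in Z/(q-1), and averaging over this parameter shows that total
   degree (k - 1)(q - 2) is enough. *)
Require Import Defs.
From mathcomp Require Import all_boot all_order all_algebra.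
From mathcomp Require Import finfield boolp mpoly zify.

Set Implicit Arguments.
Unset Strict Implicit.
Unset Printing Implicit Defensive.

(** * Separating forms and the Hilbert function *)

Section Separators.

Import GRing.Theory.
Local Open Scope ring_scope.

Lemma meval_dhomogZ (R : comNzRingType) (s d : nat) (F : {mpoly R[s]})
    (a : R) (v w : 'I_s -> R) :
  F \is d.-homog -> (forall i, w i = a * v i) -> F.@[w] = a ^+ d * F.@[v].
Proof.
move=> hF hw; rewrite !mevalE mulr_sumr; apply: eq_big_seq => m mF.
rewrite mulrCA; congr (_ * _); rewrite -(dhomog_mf hF mF). rewrite /= mdegE.
rewrite expr_sum -big_split /=; apply: eq_bigr => i _.
by rewrite hw exprMn.
Qed.

Lemma vanishing_ideal_meval (K : finFieldType) (s : nat)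
    (X : {set {set 'rV[K]_s}}) (p : {mpoly K[s]}) P v :
  vanishing_ideal X p -> P \in X -> v \in P -> p.@[v 0] = 0.
Proof.
move=> [m [c [g [gP ->]]]] PX vP; rewrite raddf_sum big1 //= => i _.
by have [_ g0] := gP i; rewrite mevalM (g0 P v PX vP) mulr0.
Qed.

(** The separating forms are a basis of the degree [d] part: a form minus its Lagrange interpolation
    vanishes on [X], and evaluation at the points gives independence. Values of a form depend on
    representatives, hence the choice [r]. *)
Lemma hilbert_card (K : finFieldType) (s d : nat) (X : {set {set 'rV[K]_s}})
    (r : {set 'rV[K]_s} -> 'rV[K]_s) :
  (forall P, P \in X -> P = proj_point (r P)) ->
  (forall P, P \in X -> exists F : {mpoly K[s]}, [/\ F \is d.-homog,
     F.@[r P 0] != 0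
   & forall Q, Q \in X -> Q != P -> F.@[r Q 0] = 0]) ->
  hilbert X d = #|X|.
Proof.
move=> Xr sep; apply/hilbertP.
have rP P : P \in X -> r P \in P.
  by move=> PX; rewrite {2}(Xr P PX); apply/imsetP; exists 1;
     rewrite ?inE ?oner_eq0 ?scale1r.
have vscale P v : P \in X -> v \in P -> exists a, v = a *: r P.
  by move=> PX; rewrite {1}(Xr P PX) => /imsetP[a _ ->]; exists a.
have [F FP] : exists F : 'I_#|X| -> {mpoly K[s]}, forall i, [/\ F i \is d.-homog,
     (F i).@[r (enum_val i) 0] != 0
   & forall Q, Q \in X -> Q != enum_val i -> (F i).@[r Q 0] = 0].
  exists (fun i => sval (cid (sep _ (enum_valP i)))) => i.
  by case: (cid _).
have Fsum (c : 'I_#|X| -> K) i :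
    (\sum_j c j *: F j).@[r (enum_val i) 0] = c i * (F i).@[r (enum_val i) 0].
  rewrite raddf_sum (bigD1 i) //= mevalZ big1 ?addr0 // => j ji.
  have [_ _ z] := FP j; rewrite mevalZ z ?mulr0 ?enum_valP //.
  by rewrite (inj_eq enum_val_inj) eq_sym.
exists F; split=> [i|v hv|c hc i]; first by case: (FP i).
- exists (fun i => v.@[r (enum_val i) 0] / (F i).@[r (enum_val i) 0]).
  set p := v - _.
  have hp : p \is d.-homog.
    by apply: rpredB => //; apply: rpred_sum => i _; apply: rpredZ; case: (FP i).
  exists 1%N, (fun=> 1), (fun=> p); split; last by rewrite big_ord1 mul1r.
  move=> _; split; first by exists d.
  move=> P w PX wP; have [a ->] := vscale _ _ PX wP.
  rewrite (meval_dhomogZ (a := a) (v := r P 0) hp); last by move=> i; rewrite mxE.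
  rewrite -(enum_rankK_in PX PX); set i := enum_rank_in _ _.
  rewrite mevalB Fsum divfK ?subrr ?mulr0 //.
  by case: (FP i).
- have := vanishing_ideal_meval hc (enum_valP i) (rP _ (enum_valP i)).
  rewrite Fsum => /eqP; rewrite mulf_eq0 => /orP[/eqP //|].
  by case: (FP i) => _ /negPf->.
Qed.

End Separators.

(** * Edge weights on an even cycle *)

Section CycleWeights.

Import GRing.Theory.

Lemma inZpD (m a b : nat) : inZp (a + b) = (inZp a + inZp b)%R :> 'I_m.+1.
Proof. by apply: val_inj; rewrite /= modnDm. Qed.

Lemma inZp_sum (m : nat) (I : finType) (F : I -> nat) :
  inZp (\sum_i F i) = (\sum_i inZp (F i))%R :> 'I_m.+1.
Proof.
by apply: (big_morph (@inZp m) (@inZpD m)); apply: val_inj; rewrite /= mod0n.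
Qed.

(** [h] permutes the residues; the sum is doubled to avoid a division. *)
Lemma sum_ord_injective (m : nat) (h : 'I_m.+1 -> 'I_m.+1) :
  injective h -> 2 * \sum_t (h t : nat) = m.+1 * m.
Proof.
move=> hI; rewrite -(reindex_inj hI (P := xpredT) (F := @nat_of_ord m.+1)) /=.
rewrite -(big_mkord xpredT (fun i => i)) bin2_sum bin2 /= mulnC -[X in _ * X]/2 muln2 halfK oddM /=.
by case: (odd m); rewrite subn0.
Qed.

Fixpoint alternate (m : nat) (c : nat -> 'I_m.+1) (t : 'I_m.+1) (i : nat) :
    'I_m.+1 :=
  if i is j.+1 then (c j - alternate c t j)%R else t.

Lemma alternate_inj (m : nat) (c : nat -> 'I_m.+1) (i : nat) :
  injective (fun t => alternate c t i).
Proof.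
elim: i => [//|i IH] t t' /= /addrI /oppr_inj; exact: IH.
Qed.

(** Entries [2i+1] and [2i+2] pair up to [c (2i+1)]. As the number of terms is odd, [t] survives, so
    the sum is injective in [t]. *)
Lemma sum_alternate (m : nat) (c : nat -> 'I_m.+1) (t : 'I_m.+1) (k : nat) :
  (\sum_(i < k.*2.+1) alternate c t i = t + \sum_(i < k) c i.*2.+1)%R.
Proof.
elim: k => [|k IH]; first by rewrite big_ord_recl !big_ord0.
by rewrite doubleS 2!big_ord_recr IH /= big_ord_recr /= -addrA subrKC addrA.
Qed.

(* Fixing the weight [t] of the first edge determines the others modulo [m.+1];
   averaged over [t], the total of the residues is [k * m], so for some [t] it
   is at most [k * m < d + m.+1], hence at most [d] since it is congruent to
   [d]. *)
Lemma cycle_weights (m k d : nat) (c : nat -> 'I_m.+1) :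
  0 < k -> (k - 1) * m <= d ->
  exists w : nat -> nat, \sum_(i < 2 * k) w i = d /\
    forall i, i.+2 < 2 * k -> w i + w i.+1 = c i %[mod m.+1].
Proof.
case: k => // k _; rewrite subn1 /= mul2n doubleS => hd.
pose u t i := alternate c t i.
(* The residue that the last weight must have for the total to be [d]. *)
pose l t : 'I_m.+1 := (inZp d - \sum_(i < k.*2.+1) u t i)%R.
pose T t := \sum_(i < k.*2.+1) (u t i : nat).
have lI : injective l.
  move=> t t' /addrI/oppr_inj; rewrite !sum_alternate; exact: addIr.
have modT t : (T t + l t = d %[mod m.+1]).
  have : inZp (T t + l t) = inZp d :> 'I_m.+1.
    rewrite inZpD inZp_sum valZpK.
    by under eq_bigr do rewrite valZpK; rewrite subrKC.
  by move/(congr1 val).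
(* As [t] varies, each of the [2k+2] weights runs once through all residues and contributes
   [m(m+1)/2]. *)
have tot : \sum_t (T t + l t) = m.+1 * (k.+1 * m).
  have := sum_ord_injective lI.
  have : 2 * \sum_t T t = k.*2.+1 * (m.+1 * m).
    rewrite exchange_big big_distrr /=.
    under eq_bigr => i _ do rewrite (sum_ord_injective (@alternate_inj m c i)).
    by rewrite sum_nat_const card_ord.
  rewrite big_split /=; nia.
have [t ht] : exists t, T t + l t <= k.+1 * m.
  apply/existsP; apply: contraT; rewrite negb_exists => /forallP h.
  have : \sum_(t < m.+1) (k.+1 * m).+1 <= \sum_t (T t + l t).
    by apply: leq_sum => t _; rewrite ltnNge h.
  by rewrite tot sum_nat_const card_ord mulnS; lia.
have hT : T t <= d.
  have := modT t; have := ltn_ord (l t).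
  rewrite leqNgt => _ h; apply/negP => lt; move/eqP: h.
  rewrite eqn_mod_dvd; last by lia.
  move/dvdn_leq; lia.
(* The last edge absorbs the slack [d - T t]: no congruence involves its weight. *)
exists (fun i => if i < k.*2.+1 then u t i : nat else d - T t); split.
  rewrite big_ord_recr /= ltnn -[RHS](subnKC hT); congr (_ + _).
  by apply: eq_bigr => i _; rewrite ltn_ord.
move=> i hi; rewrite !ifT; [|lia..].
have : (u t i + u t i.+1)%R = c i by rewrite /= addrC subrK.
by move=> <-; rewrite [val _ in RHS]/= modn_mod.
Qed.
End CycleWeights.

(** * Monomials in the edges with prescribed exponents *)

Section PulledBack.

Import GRing.Theory.
Local Open Scope ring_scope.

Definition pulled_back (K : finFieldType) (n s : nat)
    (f : s.-tuple {set 'I_n}) (d : nat) (g : 'I_n -> nat) : Prop :=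
  exists2 F : {mpoly K[s]}, F \is d.-homog
    & forall x : 'rV[K]_n, F.@[toric_param f x 0] = \prod_j x 0 j ^+ g j.

Variables (K : finFieldType) (n s : nat) (G : rel 'I_n).
Variable (f : s.-tuple {set 'I_n}).
Hypotheses (Gsimple : simple_graph G) (fG : edge_enumeration G f).

Local Notation R := (pulled_back K f).

Lemma simple_graph_neq u v : G u v -> u != v.
Proof.
by case: Gsimple => _ irr; apply: contraTneq => ->; rewrite irr.
Qed.

Lemma toric_paramE (x : 'rV[K]_n) i u v : tnth f i = [set u; v] -> u != v ->
  toric_param f x 0 i = x 0 u * x 0 v.
Proof.
move=> fi uv; rewrite mxE fi (bigD1 u) //= (bigD1 v) //=; last by rewrite eq_sym.
rewrite big1 ?mulr1 /char_vec ?inE ?eqxx ?orbT ?expr1 // => j /andP[ju jv].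
by rewrite !inE (negPf ju) (negPf jv) expr0.
Qed.

Lemma edge_ends i : exists u v, G u v /\ tnth f i = [set u; v].
Proof.
have : tnth f i \in edge_set G by rewrite -fG.2 mem_tnth.
by move/imsetP => [[u v] /=]; rewrite inE /= => Guv ->; exists u, v.
Qed.

Lemma pulled_back_ext d g g' : g =1 g' -> R d g -> R d g'.
Proof.
move=> gg [F hF hx]; exists F => // x; rewrite hx.
by apply: eq_bigr => j _; rewrite gg.
Qed.

Lemma pulled_back0 : R 0 (fun=> 0%N).
Proof.
exists 1; first exact: dhomog1.
by move=> x; rewrite meval1 big1.
Qed.

Lemma pulled_backD d d' g g' :
  R d g -> R d' g' -> R (d + d') (fun j => g j + g' j)%N.
Proof.
move=> [F hF hx] [F' hF' hx']; exists (F * F'); first exact: dhomogM.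
move=> x; rewrite mevalM hx hx' -big_split /=.
by apply: eq_bigr => j _; rewrite exprD.
Qed.

Lemma pulled_backMn w d g : R d g -> R (w * d) (fun j => w * g j)%N.
Proof.
move=> [F hF hx]; exists (F ^+ w); first by rewrite mulnC; apply: dhomogMn.
move=> x; rewrite rmorphXn /= hx -prodrXl.
by apply: eq_bigr => j _; rewrite mulnC exprM.
Qed.

Lemma pulled_back_sum m (d : 'I_m -> nat) (g : 'I_m -> 'I_n -> nat) :
  (forall i, R (d i) (g i)) -> R (\sum_i d i)%N (fun j => \sum_i g i j)%N.
Proof.
elim: m d g => [|m IH] d g h.
  rewrite big_ord0; apply: pulled_back_ext pulled_back0 => j.
  by rewrite big_ord0.
rewrite big_ord_recl; apply: pulled_back_ext (pulled_backD (h ord0)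
  (IH _ _ (fun i => h (lift ord0 i)))) => j.
by rewrite big_ord_recl.
Qed.

Lemma pulled_back_edge u v : G u v -> R 1 (fun j => (j == u) + (j == v))%N.
Proof.
move=> Guv; have uv := simple_graph_neq Guv.
have /tnthP[i fi] : [set u; v] \in f.
  by rewrite fG.2; apply/imsetP; exists (u, v); rewrite ?inE.
exists 'X_i; first by rewrite dhomogX /= mdeg1.
move=> x; rewrite mevalXU mxE -fi; apply: eq_bigr => j _.
rewrite /char_vec !inE; congr (_ ^+ _).
by case: eqP => // ->; rewrite (negPf uv).
Qed.

(** The vertices [a] and [b] are the ends of the closing edge. Every other vertex of the cycle
    receives the sum of two consecutive weights, which [cycle_weights] controls. *)
Lemma pulled_back_cycle m k d c a b (gam : 'I_n -> nat) :
  (1 < k)%N -> ((k - 1) * m <= d)%N -> size c = (2 * k)%N -> ucycle G c ->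
  a = head a c -> b = last a c ->
  exists g, [/\ R d g,
    forall v, v \in c -> v != a -> v != b -> g v = gam v %[mod m.+1]
  & forall v, v \notin c -> g v = 0%N].
Proof.
case: c => [|x p] k1 hd sc; first by rewrite /= in sc; lia.
move=> /andP[cyc uc] /= -> bE; subst b.
set c := x :: p in sc uc *.
have [w [wd wc]] := cycle_weights (fun i => inZp (gam (nth x c i.+1)))
   (ltnW k1) hd.
(* Edge [i] joins [nth x c i] to its cyclic successor, which is entry [i] of [rcons p x]. *)
exists (fun v => \sum_(i < 2 * k) w i * ((v == nth x c i)
                                   + (v == nth x (rcons p x) i)))%N; split.
- rewrite -wd; apply: pulled_back_sum => i; rewrite -[X in R X]muln1.
  apply: pulled_backMn; apply: pulled_back_edge.
  have /= /(pathP x) /(_ i) := cyc.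
  have lt : (i < (size p).+1)%N by rewrite -[(size p).+1]/(size c) sc.
  by rewrite size_rcons => /(_ lt); rewrite -rcons_cons nth_rcons lt.
- move=> v vc vx vl; rewrite /= in sc.
  have vlt : (index v c < size c)%N by rewrite index_mem.
  have vE := nth_index x vc; move: vlt vE; case: (index v c) => [|j] vlt vE.
    by rewrite -vE eqxx in vx.
  have jlt : (j.+2 < 2 * k)%N.
    rewrite -sc ltn_neqAle; move: vlt; rewrite /= => ->; rewrite andbT.
    apply: contraNneq vl => jE; rewrite -vE /c /= (last_nth x).
    by case: (size p) jE => // q [<-].
  have j1 : (j.+1 < 2 * k)%N by lia.
  have j0 : (j < 2 * k)%N by lia.
  (* The vertex in position [j.+1] lies on edges [j] and [j.+1] only. *)
  under eq_bigr => i _.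
    have -> : (v == nth x c i) = (i == Ordinal j1).
      by rewrite -vE nth_uniq ?[size c]/= ?sc // eq_sym.
    have -> : (v == nth x (rcons p x) i) = (i == Ordinal j0).
      rewrite -vE nth_rcons /=; case: ltnP => ip.
        by case/andP: uc => _ up; rewrite (nth_uniq x (vlt : (j < size p)%N) ip up) eq_sym.
      rewrite if_same [nth x p j]vE (negPf vx); apply/esym/eqP => /(congr1 val).
      by rewrite /=; lia.
    rewrite mulnDr; over.
  rewrite big_split /= (bigD1 (Ordinal j1)) //= eqxx muln1 big1 ?addn0; last first.
    by move=> i /negPf->; rewrite muln0.
  rewrite (bigD1 (Ordinal j0)) //= eqxx muln1 big1 ?addn0; last first.
    by move=> i /negPf->; rewrite muln0.
  by rewrite addnC wc // vE /= modn_mod.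
- move=> v vc; rewrite big1 // => i _; rewrite /= in sc.
  have ic : (i < size c)%N by rewrite /= sc.
  rewrite [v == _](contraNF _ vc); last by move/eqP->; rewrite mem_nth.
  rewrite [v == _](contraNF _ vc) ?muln0 // => /eqP->.
  have : nth x (rcons p x) i \in rcons p x by rewrite mem_nth ?size_rcons.
  by rewrite mem_rcons.
Qed.

(* A new vertex joined to [U] takes its residue from the joining edge, which
   costs at most [m] in degree. *)
Lemma pulled_back_extend m k d c a b (gam : 'I_n -> nat) :
  connected_graph G ->
  (1 < k)%N -> ((n - k - 1) * m <= d)%N -> size c = (2 * k)%N -> ucycle G c ->
  a = head a c -> b = last a c ->
  exists2 g, R d g
    & forall v, v != a -> v != b -> g v = gam v %[mod m.+1].
Proof.
move=> [_ Gconn] k1 hd sc uc ac bc.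
(* Both [d] and [gam] are quantified because adding a vertex changes them; exponents vanish outside
   [U] so that the new vertex gets its residue from the new edge alone. *)
pose ok (U : {set 'I_n}) := [set v in c] \subset U /\
  forall d gam, ((k - 1 + (#|U| - 2 * k)) * m <= d)%N ->
  exists g, [/\ R d g,
    forall v, v \in U -> v != a -> v != b -> g v = gam v %[mod m.+1]
  & forall v, v \notin U -> g v = 0%N].
have cardc : #|[set v in c]| = (2 * k)%N.
  by rewrite cardsE -sc; apply/card_uniqP; case/andP: uc.
have ok0 : `[< ok [set v in c] >].
  apply/asboolP; split=> // d' gam'; rewrite cardc subnn addn0 => hd'.
  have [g [Rg g1 g2]] := pulled_back_cycle gam' k1 hd' sc uc ac bc.
  by exists g; split=> // v; rewrite inE; [apply: g1 | apply: g2].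
have [U /maxsetP[/asboolP[cU okU] Umax] _] := @maxset_exists _ (fun U => `[< ok U >]) _ ok0.
have UT : U = setT.
  apply: contrapT => UT.
  have [u [v [uU vU Guv]]] : exists u v, [/\ u \in U, v \notin U & G u v].
    apply: contrapT => nex; apply: UT; apply/setP => v; rewrite inE.
    have cl : closed G (mem U).
      move=> y z Gyz; apply/idP/idP => hy; apply: contrapT => /negP hz; apply: nex.
        by exists y, z.
      by exists z, y; split=> //; case: Gsimple => -> _.
    have aU : a \in U.
      apply: (subsetP cU); rewrite inE; move: sc ac; case: (c) => [|y q] /=; first by lia.
      by move=> _ ->; rewrite mem_head.
    by rewrite -(closed_connect cl (Gconn a v)) aU.
  have cardU : (2 * k <= #|U|)%N by rewrite -cardc subset_leq_card.
  have /Umax : `[< ok (v |: U) >].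
    apply/asboolP; split; first by apply: subset_trans cU (subsetUr _ _).
    move=> d' gam'; rewrite cardsU1 vU => hd'.
    set r := (gam' v %% m.+1)%N.
    have rm : (r <= m)%N by rewrite -ltnS ltn_mod.
    (* Weight [r] on the edge [uv] also adds [r] at [u]; this is compensated beforehand by [r * m],
       which is [-r] modulo [m.+1]. *)
    have [|g [Rg g1 g2]] := okU (d' - r)%N
      (fun z => gam' z + (z == u) * (r * m))%N; first by nia.
    exists (fun z => g z + r * ((z == u) + (z == v)))%N; split.
    - have -> : d' = (d' - r + r * 1)%N by nia.
      by apply: pulled_backD => //; apply: pulled_backMn; apply: pulled_back_edge.
    - move=> z; rewrite !inE; have [->|zv /= zU za zb] := eqVneq z v.
        move=> _ _ _; rewrite g2 // eq_sym (negPf (simple_graph_neq Guv)).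
        by rewrite muln1 modn_mod.
      rewrite addn0 -modnDml g1 // modnDml -addnA.
      rewrite [X in (_ + X)%N](_ : _ = (z == u) * r * m.+1)%N ?modnMDr //.
        by rewrite addnC modnMDl.
      by rewrite mulnS addnC mulnA [(r * _)%N]mulnC.
    - move=> z; rewrite !inE negb_or => /andP[zv zU].
      rewrite g2 // (negPf zv) [z == u](contraNF _ zU) ?muln0 //.
      by move/eqP->.
  move=> /(_ (subsetUr _ _)) vUE; case/negP: vU.
  by rewrite -vUE setU11.
have := okU d gam; rewrite UT cardsT card_ord.
(* This makes [k - 1 + (n - 2k)] equal to [n - k - 1] despite truncated subtraction. *)
have : (2 * k <= n)%N by rewrite -cardc -[leqRHS]card_ord max_card.
move=> kn []; first by apply: leq_trans hd; rewrite leq_mul2r; lia.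
by move=> g [Rg g1 _]; exists g => // v; apply: g1; rewrite inE.
Qed.

End PulledBack.

(** * Separating the points of the toric set over a field with [m.+2] elements *)

Section ToricSeparators.

Import GRing.Theory.
Local Open Scope ring_scope.

(** Translation by 1 permutes [K], so adding 1 to every element leaves the sum of all elements
    unchanged. *)
Lemma finField_natr_card (K : finFieldType) : #|K|%:R = 0 :> K.
Proof.
have := reindex_inj (addIr (1 : K)) (P := xpredT) (F := id) (op := +%R) (x := 0).
move/eqP; rewrite big_split /= -subr_eq0 opprD addrA subrr sub0r oppr_eq0.
by rewrite sumr_const => /eqP.
Qed.

Variables (K : finFieldType) (n s m : nat) (G : rel 'I_n).
Variable (f : s.-tuple {set 'I_n}).
Hypotheses (Gsimple : simple_graph G) (fG : edge_enumeration G f).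
Hypothesis (Km : #|K| = m.+2).

Lemma sum_powers_eq0 (z : K) : z != 0 -> z != 1 -> \sum_(i < m.+1) z ^+ i = 0.
Proof.
move=> z0 z1; apply: (mulfI (x := z - 1)); first by rewrite subr_eq0.
rewrite mulr0 -subrX1; apply: (mulfI z0); rewrite mulr0 mulrBr mulr1 -exprS.
by rewrite -Km expf_card subrr.
Qed.

Lemma expr_mod_card (z : K) i j : z != 0 -> i = j %[mod m.+1] -> z ^+ i = z ^+ j.
Proof.
move=> z0 ij; have zm : z ^+ m.+1 = 1.
  by apply: (mulfI z0); rewrite -exprS -Km expf_card mulr1.
have zE l : z ^+ l = z ^+ (l %% m.+1).
  by rewrite {1}(divn_eq l m.+1) exprD mulnC exprM zm expr1n mul1r.
by rewrite zE ij -zE.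
Qed.

(* Rescaling the two sides of the bipartition does not move the projective
   point, so it can be assumed that [x] and [x0] agree at [a] and [b]; then the
   unknown exponents at [a] and [b] are harmless, and the form restricts to the
   expansion of the indicator function [\prod_j \sum_(i < q - 1) (x j / x0 j) ^+ i]. *)
Lemma toric_separator d a b (x0 : 'rV[K]_n) :
  bipartite G -> G a b ->
  (forall gam : 'I_n -> nat, exists2 g, pulled_back K f d g
    & forall v, v != a -> v != b -> g v = gam v %[mod m.+1]) ->
  (forall j, x0 0 j != 0) ->
  exists F : {mpoly K[s]}, [/\ F \is d.-homog, F.@[toric_param f x0 0] != 0
    & forall x : 'rV[K]_n, (forall j, x 0 j != 0) ->
      F.@[toric_param f x 0] != 0 ->
      proj_point (toric_param f x) = proj_point (toric_param f x0)].
Proof.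
move=> [A bipA] Gab real x0nz.
have [|g gP] := @choice {ffun 'I_n -> 'I_m.+1} ('I_n -> nat) (fun gam g =>
    pulled_back K f d g
    /\ forall v, v != a -> v != b -> g v = gam v %[mod m.+1]).
  by move=> gam; have [g ? ?] := real (fun v => gam v : nat); exists g.
have [|H HP] := @choice {ffun 'I_n -> 'I_m.+1} {mpoly K[s]} (fun gam F =>
    F \is d.-homog
    /\ forall x : 'rV[K]_n, F.@[toric_param f x 0]
                     = \prod_j x 0 j ^+ g gam j).
  by move=> gam; have [[F ? ?] _] := gP gam; exists F.
(* Each monomial is normalised to the value 1 at [x0], so that powers of the ratios to [x0]
   appear. *)
pose F := \sum_gam (\prod_j x0 0 j ^+ g gam j)^-1 *: H gam.
have hF : F \is d.-homog.
  by apply: rpred_sum => gam _; apply: rpredZ; case: (HP gam).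
have FE (y : 'rV[K]_n) : (forall j, y 0 j != 0) ->
    y 0 a = x0 0 a -> y 0 b = x0 0 b ->
    F.@[toric_param f y 0] = \prod_j \sum_(i < m.+1) (y 0 j / x0 0 j) ^+ i.
  move=> ynz ya yb; rewrite bigA_distr_bigA /= raddf_sum.
  apply: eq_bigr => gam _; rewrite /= mevalZ (HP gam).2 mulrC -prodfV -big_split /=.
  apply: eq_bigr => j _; rewrite -exprVn -exprMn.
  have [->|ja] := eqVneq j a; first by rewrite ya divff // !expr1n.
  have [->|jb] := eqVneq j b; first by rewrite yb divff // !expr1n.
  by apply: expr_mod_card; [rewrite mulf_neq0 ?invr_eq0 | apply: (gP gam).2].
exists F; split=> //.
  rewrite FE //; apply/prodf_neq0 => j _; rewrite divff //.
  under eq_bigr do rewrite expr1n.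
  (* Each factor is [q - 1] in [K]; were it zero, [q = 0] in [K] would give [1 = 0]. *)
  rewrite sumr_const card_ord; apply/eqP => mK.
  have := finField_natr_card K; rewrite Km mulrS mK addr0.
  by apply/eqP; rewrite oner_eq0.
move=> x xnz Fx.
pose z v := x 0 v / x0 0 v.
have znz v : z v != 0 by rewrite mulf_neq0 ?invr_eq0.
(* One scalar per side of the bipartition: every edge has an end on each side, so each edge
   coordinate is divided by the same [z a * z b]. *)
pose c v := if (v \in A) == (a \in A) then z a else z b.
have zab : z a * z b != 0 by rewrite (mulf_neq0 (znz a)).
have cnz v : c v != 0 by rewrite /c; case: ifP.
have ca : c a = z a by rewrite /c eqxx.
have cb : c b = z b.
  by rewrite /c; have := bipA _ _ Gab; rewrite eq_sym => /negPf->.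
pose y : 'rV[K]_n := \row_v (x 0 v / c v).
have ynz v : y 0 v != 0 by rewrite mxE mulf_neq0 ?invr_eq0.
have xy : toric_param f x = (z a * z b) *: toric_param f y.
  apply/rowP => i; rewrite [RHS]mxE; have [u [v [Guv fi]]] := edge_ends fG i.
  rewrite !(toric_paramE _ fi (simple_graph_neq Gsimple Guv)) !mxE.
  have -> : z a * z b = c u * c v.
    have := bipA _ _ Guv; rewrite /c.
    case: (u \in A); case: (v \in A); case: (a \in A) => //= _; exact: mulrC.
  by rewrite [RHS]mulrACA ![c _ * _]mulrC !divfK.
have Fy : F.@[toric_param f y 0] != 0.
  apply: contra_neq Fx => Fy0.
  rewrite (meval_dhomogZ (a := z a * z b) (v := toric_param f y 0) hF) ?Fy0 ?mulr0 //.
  by move=> i; rewrite xy mxE.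
have yx0 : y = x0.
  (* A coordinate where [y] and [x0] differ makes its geometric sum, hence the whole product,
     vanish. *)
  apply/rowP => v; apply: contraNeq Fy => yv.
  rewrite FE ?mxE ?ca ?cb //; last 2 first.
  - by rewrite /z invfM invrK mulrA divff // mul1r.
  - by rewrite /z invfM invrK mulrA divff // mul1r.
  apply/prodf_eq0; exists v => //; rewrite sum_powers_eq0 //.
    by rewrite mulf_neq0 ?invr_eq0.
  by apply: contraNneq yv => /divr1_eq->.
rewrite xy yx0; apply/setP => w; apply/imsetP/imsetP => -[e].
  rewrite inE => e0 ->; exists (e * (z a * z b)); rewrite ?scalerA // inE.
  by rewrite mulf_neq0.
rewrite inE => e0 ->; exists (e / (z a * z b)); rewrite ?inE.
  by rewrite mulf_neq0 ?invr_eq0.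
by rewrite scalerA divfK.
Qed.

End ToricSeparators.

(** * The regularity bound *)

Lemma hilbert_toric_set (K : finFieldType) (n k s d : nat)
    (G : rel 'I_n) (f : s.-tuple {set 'I_n}) (c : seq 'I_n) :
  simple_graph G -> edge_enumeration G f -> connected_graph G -> bipartite G ->
  graph_cycle G c -> size c = 2 * k -> (#|K| - 2) * (n - k - 1) <= d ->
  hilbert (toric_set K f) d = #|toric_set K f|.
Proof.
move=> Gs fG Gc Gb [c2 uc] sc hd.
have k1 : 1 < k by lia.
have [m Km] : exists m, #|K| = m.+2.
  by case: #|K| (finNzRing_gt1 K) => [|[|m]] // _; exists m.
case: c => [//|a p] in c2 uc sc *; pose b := last a p.
(* The closing edge of the cycle provides the two vertices with free exponents. *)
have Gba : G b a.
  by case/andP: uc; rewrite /= rcons_path => /andP[].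
have [|r rP] := @choice {set 'rV[K]_s} 'rV[K]_n (fun P x =>
    P \in toric_set K f ->
    (forall j, x ord0 j != 0%R) /\ P = proj_point (toric_param f x)).
  move=> P; have [/imsetP[x]|_] := boolP (P \in toric_set K f).
    by rewrite inE => /forallP xnz ->; exists x.
  by exists 0%R.
apply: (hilbert_card (r := fun P => toric_param f (r P))) => [P /rP[] //|P PX].
have [rnz PE] := rP P PX.
have [|F [hF F0 Fsep]] := toric_separator Gs fG Km (d := d) Gb Gba _ rnz.
  move=> gam; have [|g Rg gg] := @pulled_back_extend K n s G f Gs fG m k d
    (a :: p) a b gam Gc k1 _ sc uc erefl erefl.
    by rewrite mulnC; move: hd; rewrite Km !subSS subn0.
  by exists g => // v vb va; apply: gg.
exists F; split=> // Q QX; apply: contraNeq => FQ.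
by rewrite (rP Q QX).2 PE; apply/eqP/Fsep => //; case: (rP Q QX).
Qed.

Theorem corollary2p31 (K : finFieldType) (n k s : nat)
    (G : rel 'I_n) (f : s.-tuple {set 'I_n}) :
  #|K| <> 2 ->
  simple_graph G ->
  edge_enumeration G f ->
  connected_graph G ->
  bipartite G ->
  largest_cycle_length G (2 * k) ->
  exists2 r : nat, is_regularity (toric_set K f) r
                 & r <= (#|K| - 2) * (n - k - 1).
Proof.
move=> _ Gs fG Gc Gb [[c cyc sc] _].
pose stable p := `[< forall d, p <= d -> hilbert (toric_set K f) d
                                         = #|toric_set K f| >].
have st : stable ((#|K| - 2) * (n - k - 1)).
  by apply/asboolP => d; apply: hilbert_toric_set Gs fG Gc Gb cyc sc.
have ex : exists p, stable p by exists ((#|K| - 2) * (n - k - 1)).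
case: (ex_minnP ex) => r /asboolP rst rmin; exists r; last exact: rmin.
by split=> // p /asboolP; apply: rmin.
Qed.
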